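(* For every integer $r\ge2$, $$C_r=\sum_{\nu\vdash r-1}C_\nu,$$ where, under the one-to-one correspondence $\nu=(\nu_1,\ldots,\nu_d)\leftrightarrow\{(\nu_1+1,\ldots,\nu_d+1,1^m): m\ge0\}$ between partitions $\nu\vdash r-1$ and the Young-shape families of partitions $\mu$ with $|\mu|-\ell(\mu)=r-1$, the term $C_\nu$ is the one associated with the family $(\nu_1+1,\ldots,\nu_d+1,1^m)$, $m\ge0$.
   Context: For a partition $\mu$, $|\mu|$ is the sum of its parts, $\ell(\mu)$ is its number of positive parts, and $\nu\vdash N$ means $|\nu|=N$. The notation $1^m$ means $m$ parts equal to $1$. Let $$\mathcal H(u)=\prod_{q=1}^\infty\frac{q}{q+1}\left(1+\frac{e^{u/q}-1}{u}\right)$$ (with the removable singularity at $u=0$ filled in; the product converges locally uniformly near $u=0$), and let $C_r=[u^{r-1}]\mathcal H(u)$ be the coefficient of $u^{r-1}$ in its Taylor expansion at $0$. For $k,q\ge1$ put $$a_k(q)=\frac{1}{(k+1)!\,q^k(q+1)}.$$ For a partition $\nu=(\nu_1,\ldots,\nu_d)\vdash r-1$, let $m_j(\nu)$ be the multiplicity of the part $j$ in $\nu$, and define $$C_\nu=\frac{1}{\prod_{j\ge1}m_j(\nu)!}\sum_{\substack{q_1,\ldots,q_d\ge1\\ q_a\ne q_b\ (a\ne b)}}\ \prod_{s=1}^d a_{\nu_s}(q_s),$$ which is an absolutely convergent sum over ordered $d$-tuples of distinct positive integers. *)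

(* Defs.v *)
From HB Require Import structures.
From mathcomp Require Import all_boot all_order all_algebra.
From mathcomp Require Import all_classical all_reals all_analysis.
Set Implicit Arguments.
Unset Strict Implicit.
Unset Printing Implicit Defensive.
Import Order.TTheory GRing.Theory Num.Theory.
Import numFieldNormedType.Exports.
Local Open Scope classical_set_scope.
Local Open Scope ring_scope.

(* A partition is the weakly decreasing sequence of its positive parts, so
   that |mu| = sumn mu and l(mu) = size mu. *)
Definition is_partition (mu : seq nat) : bool :=
  sorted geq mu && (0%N \notin mu).

Definition partitions (N : nat) : set (seq nat) :=
  [set nu | is_partition nu /\ sumn nu = N].

(* The shape (nu_1 + 1, ..., nu_d + 1, 1^m). *)
Definition shape (nu : seq nat) (m : nat) : seq nat :=
  map succn nu ++ nseq m 1%N.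

Definition shape_family (nu : seq nat) : set (seq nat) := range (shape nu).

(* Two partitions lie in the same family when they have the same parts larger
   than 1. The set [shape_families n] consists of the classes of this
   equivalence on the partitions mu with |mu| - l(mu) = n. The subtraction of
   natural numbers is exact here, since l(mu) <= |mu|. *)
Definition big_parts (mu : seq nat) : seq nat := [seq k <- mu | (1 < k)%N].

Definition shape_families (n : nat) : set (set (seq nat)) :=
  [set F | exists2 mu : seq nat,
     is_partition mu /\ (sumn mu - size mu)%N = n &
     F = [set mu' | is_partition mu' /\ big_parts mu' = big_parts mu]].

Section Coefficients.
Variable R : realType.

(* (e^{u/q} - 1)/u, extended by its limit 1/q at u = 0. *)
Definition expquot (q : nat) (u : R) : R :=
  if u == 0 then q%:R^-1 else (expR (u / q%:R) - 1) / u.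

Definition Hfactor (q : nat) (u : R) : R :=
  q%:R / q.+1%:R * (1 + expquot q u).

Definition Hprod (u : R) : R :=
  limn (fun n => \prod_(1 <= q < n.+1) Hfactor q u).

Definition taylor_coef (f : R -> R) (n : nat) : R := derive1n n f 0 / n`!%:R.

Definition Ccoef (r : nat) : R := taylor_coef Hprod r.-1.

Definition acoef (k q : nat) : R := ((k.+1)`!%:R * q%:R ^+ k * q.+1%:R)^-1.

Definition distinct_pos (d : nat) : set (d.-tuple nat) :=
  [set t : d.-tuple nat | uniq t /\ (forall i : 'I_d, 0 < tnth t i)%N].

(* The terms are nonnegative, so the absolutely convergent sum is the
   extended-real sum [esum]. Only the multiplicities of the parts that occur in
   nu contribute to the product of the m_j(nu)!. *)
Definition Cpart (nu : seq nat) : \bar R :=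
  (((\prod_(j <- undup nu) (count_mem j nu)`!)%:R^-1)%:E *
   \esum_(t in @distinct_pos (size nu))
     (\prod_(s < size nu) acoef (nth 0%N nu s) (tnth t s))%:E)%E.

End Coefficients.

Lemma finite_partitions (N : nat) : finite_set (partitions N).
Proof.
have szP (nu : seq nat) : 0%N \notin nu -> (size nu <= sumn nu)%N.
  elim: nu => //= a s IH; rewrite inE negb_or eq_sym => /andP[a0 /IH h].
  by rewrite -add1n leq_add// lt0n.
have leP (nu : seq nat) k : k \in nu -> (k <= sumn nu)%N.
  elim: nu => //= a s IH; rewrite inE => /predU1P[->|/IH h].
    exact: leq_addr.
  exact: leq_trans h (leq_addl _ _).
pose f (t : N.-bseq 'I_N.+1) : seq nat := map val t.
apply: (@sub_finite_set _ _ (f @` setT)); last exact/finite_image/finite_finset.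
move=> nu [/andP[_ nu0] nuN].
have sz : (size (map (@inord N) nu) <= N)%N by rewrite size_map -nuN szP.
exists (Bseq sz) => //; rewrite /f /= -map_comp -[RHS]map_id.
apply/eq_in_map => k knu /=; rewrite inordK// ltnS -nuN; exact: leP.
Qed.

Lemma expquot_cvg0 (R : realType) (q : nat) :
  (expR (u / q%:R) - 1) / u @[u --> (0 : R)^'] --> expquot q (0 : R).
Proof.
have H : is_derive (0 : R) 1 (fun u : R => expR (u / q%:R)) q%:R^-1.
  apply: is_derive_eq.
  by rewrite mul0r expR0 mul1r scaler0 add0r [LHS]mulr1.
rewrite /expquot eqxx.
have /cvg_ex[l hl] : derivable (fun u : R => expR (u / q%:R)) 0 1.
  exact: ex_derive.
have lE : l = q%:R^-1.
  by rewrite -(@derive_val _ _ _ _ _ _ _ H) /derive (cvg_lim _ hl).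
rewrite lE in hl; apply: cvg_trans hl; apply: near_eq_cvg; near=> u.
by rewrite /= addr0 mul0r expR0 [u%:A]mulr1 [LHS]mulrC.
Unshelve. all: by end_near. Qed.

(* Main.v *)
Require Import Defs.
From HB Require Import structures.
From mathcomp Require Import all_boot all_order all_algebra.
From mathcomp Require Import all_classical all_reals all_analysis.
From mathcomp Require Import finmap ring.

Set Implicit Arguments.
Unset Strict Implicit.
Unset Printing Implicit Defensive.
Import Order.TTheory GRing.Theory Num.Theory.
Import numFieldNormedType.Exports.
Local Open Scope classical_set_scope.
Local Open Scope ring_scope.

(** The [q]-th factor of the product is the power series
    [1 + \sum_(k >= 1) acoef k q * u ^+ k], whose coefficients are nonnegative.
    Expanding the product of the first [n] factors, a term of degree [N] chooses
    an exponent [f q] for each [q <= n], with sum [N]. The nonzero exponents,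
    sorted, form a partition [nu] of [N]. The terms of type [nu] are indexed by
    the ways to attach distinct integers [q] to the entries of [nu], up to the
    permutations of equal entries, so they add up to the part of [Cpart nu] in which
    all the [q_s] are at most [n]. Hence the coefficient of degree [N] of the
    partial product is the sum over [nu] of truncated [Cpart nu]
    ([Pcoef_sum_Cpart_upto]), and it remains to let [n] tend to infinity on both
    sides. On the right this is the definition of a sum of nonnegative terms
    ([cvg_Cpart_upto]).

    On the left, the coefficients of the partial products increase with [n], so
    a monotone convergence argument applies ([pseries_monotone_cvg]): if the
    partial products are bounded at each [x >= 0], their coefficients converge,
    and the power series of the limits converges everywhere to the limit of the
    partial products. A negative [u] is controlled by [`|u|]. The bound is
    [expR (expR x)], because the exponents in
    [Hfactor q x <= expR (expR x * (q^-1 - (q + 1)^-1))] telescope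
    ([prod_Hfactor_le]). Differentiating this power series term by term at [0]
    identifies its coefficients with the Taylor coefficients ([cvg_Pcoef]). The
    same monotone convergence gives Cauchy products of power series
    ([pseries_mul]), hence the expansion of the partial products.

    For the correspondence of shapes, a partition is determined by its parts
    larger than [1] together with the number of its parts equal to [1]
    ([partitionE]). Lowering the large parts by one gives [nu]. *)

(** * Shape families *)

Lemma geq_trans : transitive geq.
Proof. by move=> n m p mn np; exact: leq_trans np mn. Qed.

Lemma sumn_map_succn (s : seq nat) : sumn (map succn s) = (sumn s + size s)%N.
Proof. by elim: s => //= a s ->; rewrite addSn addnS addnA. Qed.

Lemma big_parts_succn (s : seq nat) : 0%N \notin s ->
  big_parts (map succn s) = map succn s.
Proof.
move=> s0; apply/all_filterP; rewrite all_map; apply/allP => k ks /=.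
by rewrite ltnS lt0n; apply: contraNneq s0 => <-.
Qed.

Lemma big_parts_shape (nu : seq nat) m : 0%N \notin nu ->
  big_parts (Defs.shape nu m) = map succn nu.
Proof.
move=> nu0; rewrite /Defs.shape /big_parts filter_cat -/(big_parts _).
by rewrite big_parts_succn// filter_nseq /= cats0.
Qed.

Lemma is_partition_shape nu m : is_partition nu -> is_partition (Defs.shape nu m).
Proof.
move=> /andP[snu nu0]; apply/andP; split; last first.
  rewrite mem_cat negb_or mem_nseq andbF andbT.
  by apply/mapP => -[].
rewrite /Defs.shape (sorted_pairwise geq_trans) pairwise_cat.
rewrite -!(sorted_pairwise geq_trans); apply/and3P; split.
- by apply/allrelP => x y /mapP[k _ ->] /nseqP[-> _].
- by rewrite sorted_map.
- by elim: m => // -[|m].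
Qed.

(** Since the parts decrease, the parts equal to 1 come last. *)
Lemma partitionE mu : is_partition mu ->
  mu = big_parts mu ++ nseq (count_mem 1%N mu) 1%N.
Proof.
elim: mu => // a mu IH /andP[/= amu]; rewrite inE negb_or => /andP[a0 mu0].
have smu : is_partition mu by rewrite /is_partition (path_sorted amu).
case: (ltnP 1 a) => a1; first by rewrite gtn_eqF//= -IH.
have {a0}a1 : a = 1%N by apply/eqP; rewrite eqn_leq a1 lt0n eq_sym.
have /all_pred1P mu1 : all (pred1 1%N) mu.
  apply/allP => k kmu /=; rewrite eqn_leq lt0n (contraNneq _ mu0) => [|<-//].
  move: amu; rewrite (path_sortedE geq_trans) a1 => /andP[/allP].
  by move=> /(_ _ kmu) /= -> _.
by rewrite a1 /= mu1 {1}/big_parts filter_nseq count_nseq/= mul1n.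
Qed.

(** This puts the range of [shape nu] in the form in which the classes of
    [shape_families] are given. *)
Lemma shape_family_big_parts nu : is_partition nu ->
  shape_family nu =
  [set mu | is_partition mu /\ big_parts mu = map succn nu].
Proof.
move=> nuP; have /andP[_ nu0] := nuP; apply/seteqP; split=> [_ [m _ <-]|mu] /=.
  by rewrite is_partition_shape// big_parts_shape.
by move=> [muP mub]; exists (count_mem 1%N mu) => //;
  rewrite /Defs.shape -mub -partitionE.
Qed.

Lemma is_partition_pred_big_parts mu : is_partition mu ->
  is_partition (map predn (big_parts mu)).
Proof.
move=> /andP[smu _]; apply/andP; split; last first.
  by apply/mapP => -[[|[|k]]]; rewrite mem_filter.
rewrite sorted_map; apply: sub_sorted (sorted_filter _ _ smu).
- by move=> x y /= yx; rewrite -!subn1 leq_sub2r.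
- exact: geq_trans.
Qed.

Lemma map_succn_pred_big_parts mu :
  map succn (map predn (big_parts mu)) = big_parts mu.
Proof.
by rewrite -map_comp map_id_in// => -[|k]; rewrite mem_filter.
Qed.

Lemma shape_family_bij N :
  set_bij (partitions N) (shape_families N) shape_family.
Proof.
split=> [nu [nuP nuN]|nu nu' /set_mem[nuP _] /set_mem[nuP' _] nunu'|F [mu [muP muN] ->]].
- have /andP[_ nu0] := nuP.
  exists (Defs.shape nu 0) => [|/=]; last first.
    by rewrite shape_family_big_parts// big_parts_shape.
  split; first exact: is_partition_shape.
  by rewrite /Defs.shape cats0 sumn_map_succn size_map addnK.
- have : shape_family nu (Defs.shape nu 0) by exists 0%N.
  have /andP[_ nu0] := nuP.
  rewrite nunu' shape_family_big_parts// => -[_].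
  by rewrite big_parts_shape// => /(inj_map succn_inj).
- have nuP := is_partition_pred_big_parts muP.
  exists (map predn (big_parts mu)); last first.
    by rewrite /= shape_family_big_parts// map_succn_pred_big_parts.
  split=> //; rewrite -muN [in RHS](partitionE muP) size_cat size_nseq sumn_cat.
  rewrite sumn_nseq mul1n -[in RHS]map_succn_pred_big_parts sumn_map_succn.
  by rewrite !size_map -addnA addnK.
Qed.

(** * Power series with nonnegative coefficients *)

Section PowerSeries.
Variable R : realType.
Implicit Types (c d : nat -> R) (f g : R -> R) (u x : R).

Lemma le_pseries c d x M : 0 <= x -> (forall N, c N <= d N) ->
  pseries c x M <= pseries d x M.
Proof.
by move=> x0 cd; apply: ler_sum => i _; rewrite ler_wpM2r ?exprn_ge0.
Qed.

Lemma pseries_nondecreasing c x : (forall N, 0 <= c N) -> 0 <= x ->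
  nondecreasing_seq (pseries c x).
Proof.
by move=> c0 x0; apply: nondecreasing_series => n _ _; rewrite mulr_ge0// exprn_ge0.
Qed.

Lemma pseries_le_limit c f x : (forall N, 0 <= c N) -> 0 <= x ->
  pseries c x @ \oo --> f x -> forall M, pseries c x M <= f x.
Proof.
move=> c0 x0 cf M; rewrite -(cvg_lim _ cf)//; apply: nondecreasing_cvgn_le.
  exact: pseries_nondecreasing.
by apply: cvgP cf.
Qed.

Lemma pseries_horner (p : {poly R}) u : pseries (fun N => p`_N) u @ \oo --> p.[u].
Proof.
apply: cvg_near_cst; exists (size p) => // M /= pM.
by rewrite /pseries/= /series/= big_mkord (horner_coef_wide _ pM).
Qed.

Lemma is_cvg_pseries_ge0 c : (forall N, 0 <= c N) ->
  (forall x, 0 <= x -> cvgn (pseries c x)) -> forall u, cvgn (pseries c u).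
Proof.
move=> c0 cc u; have x0 : 0 <= `|u| + 1 by rewrite addr_ge0.
apply: is_cvg_pseries_inside (cc _ x0) _.
by rewrite (ger0_norm x0) ltrDl.
Qed.

(** Monotone convergence for power series with nonnegative coefficients. On
    the nonnegative half-line everything is monotone, so limits exchange. At a
    negative [u], the error is dominated by the error at [`|u|], since the
    coefficients [l N - c n N] are nonnegative. *)
Lemma pseries_monotone_cvg (c : nat -> nat -> R) (f : nat -> R -> R) :
  (forall n N, 0 <= c n N) -> (forall N, nondecreasing_seq (c ^~ N)) ->
  (forall n u, pseries (c n) u @ \oo --> f n u) ->
  (forall x, 0 <= x -> exists B, forall n, f n x <= B) ->
  exists l : nat -> R,
    [/\ forall N, 0 <= l N, forall N, c n N @[n --> \oo] --> l N &
        forall u, cvgn (pseries l u) /\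
          f n u @[n --> \oo] --> limn (pseries l u)].
Proof.
move=> c0 cnd cf fB.
have cle n x M : 0 <= x -> pseries (c n) x M <= f n x.
  by move=> x0; exact: pseries_le_limit.
(* At [x = 1] the value bounds each coefficient. *)
have coefle n N : c n N <= f n 1.
  apply: le_trans (cle n 1 N.+1 ler01).
  rewrite /pseries/= /series/= big_nat_recr//= expr1n mulr1 lerDr.
  by apply: sumr_ge0 => i _; rewrite expr1n mulr1.
have ccvg N : cvgn (c ^~ N).
  have [B hB] := fB _ ler01; apply: nondecreasing_is_cvgn => //.
  by exists B => _ [n _ <-]; rewrite (le_trans (coefle _ _)).
pose l N := limn (c ^~ N); exists l.
have cl N : c n N @[n --> \oo] --> l N by exact: ccvg.
have lec n N : c n N <= l N by exact: (nondecreasing_cvgn_le (cnd N) (ccvg N)).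
have l0 N : 0 <= l N by exact: le_trans (c0 0%N N) (lec _ _).
have Sl u M : pseries (c n) u M @[n --> \oo] --> pseries l u M.
  by apply: cvg_big => [|i _]; [exact: add_continuous|]; apply: cvgMl; exact: cl.
have pos x : 0 <= x ->
    cvgn (pseries l x) /\ f n x @[n --> \oo] --> limn (pseries l x).
  move=> x0; have [B hB] := fB _ x0.
  have fnd : nondecreasing_seq (f ^~ x).
    move=> m n mn; apply: ler_cvg_to (cf m x) (cf n x) _; apply: nearW => M.
    by apply: le_pseries => // N; exact: cnd.
  have fcvg : cvgn (f ^~ x).
    by apply: nondecreasing_is_cvgn => //; exists B => _ [n _ <-].
  have lG M : pseries l x M <= limn (f ^~ x).
    by apply: ler_cvg_to (Sl x M) fcvg _; apply: nearW => n; exact: cle.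
  have lcvg : cvgn (pseries l x).
    apply: nondecreasing_is_cvgn; first exact: pseries_nondecreasing.
    by exists (limn (f ^~ x)) => _ [n _ <-].
  split=> //; suff -> : limn (pseries l x) = limn (f ^~ x) by exact: fcvg.
  apply/eqP; rewrite eq_le; apply/andP; split.
    by apply: limr_le => //; exact: nearW.
  apply: limr_le => //; apply: nearW => n.
  by apply: ler_cvg_to (cf n x) lcvg _; apply: nearW => M; exact: le_pseries.
have lcvg := is_cvg_pseries_ge0 l0 (fun x xge0 => (pos x xge0).1).
split=> // u; split=> //.
have dom n : `|limn (pseries l u) - f n u| <=
             limn (pseries l `|u|) - f n `|u|.
  have h1 : `|pseries l u M - pseries (c n) u M| @[M --> \oo] -->
            `|limn (pseries l u) - f n u|.
    by apply: cvg_norm; apply: cvgB => //; exact: lcvg.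
  have h2 : pseries l `|u| M - pseries (c n) `|u| M @[M --> \oo] -->
            limn (pseries l `|u|) - f n `|u|.
    by apply: cvgB => //; exact: lcvg.
  apply: ler_cvg_to h1 h2 _; apply: nearW => M.
  rewrite /pseries/= /series/= -!sumrB; apply: le_trans (ler_norm_sum _ _ _) _.
  apply: ler_sum => i _; rewrite -!mulrBl normrM normrX ler_pM//.
  by rewrite ger0_norm// subr_ge0.
apply/cvgrPdist_le => e e0.
have /cvgrPdist_le/(_ e e0) := (pos `|u| (normr_ge0 u)).2.
apply: filterS => n; apply: le_trans; apply: le_trans (dom n) _; exact: ler_norm.
Qed.

(** The Cauchy product of two power series with nonnegative coefficients: the
    products of the truncations increase to it coefficientwise. *)
Lemma pseries_mul c d f g :
  (forall N, 0 <= c N) -> (forall N, 0 <= d N) ->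
  (forall u, pseries c u @ \oo --> f u) -> (forall u, pseries d u @ \oo --> g u) ->
  forall u, pseries (fun N => \sum_(i < N.+1) c i * d (N - i)%N) u @ \oo -->
    f u * g u.
Proof.
move=> c0 d0 cf dg.
pose t c M : {poly R} := \poly_(i < M) c i.
have tE (e : nat -> R) u M : (t e M).[u] = pseries e u M.
  by rewrite horner_poly /pseries/= /series/= big_mkord.
have t0 (e : nat -> R) M i : (forall N, 0 <= e N) -> 0 <= (t e M)`_i.
  by move=> e0; rewrite coef_poly; case: ifP.
have tnd (e : nat -> R) i : (forall N, 0 <= e N) ->
    nondecreasing_seq (fun M => (t e M)`_i).
  move=> e0 m n mn; rewrite !coef_poly.
  by case: ltnP => [im|_]; [rewrite (leq_trans im mn)|case: ifP].
have [] := @pseries_monotone_cvg (fun M N => (t c M * t d M)`_N)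
   (fun M u => (t c M * t d M).[u]).
- by move=> n N; rewrite coefM sumr_ge0// => i _; rewrite mulr_ge0// t0.
- move=> N m n mn; rewrite !coefM; apply: ler_sum => i _.
  by rewrite ler_pM ?t0//; exact: tnd.
- by move=> n u; exact: pseries_horner.
- move=> x x0; exists (f x * g x) => n; rewrite hornerM !tE.
  rewrite ler_pM//; try by rewrite sumr_ge0// => i _; rewrite mulr_ge0// exprn_ge0.
  + exact: pseries_le_limit.
  + exact: pseries_le_limit.
move=> l [_ cl hl].
have <- : l = fun N => \sum_(i < N.+1) c i * d (N - i)%N.
  apply/funext => N; rewrite -(cvg_lim _ (cl N))//; apply: lim_near_cst => //.
  exists N.+1 => // M /= NM; rewrite coefM; apply: eq_bigr => i _.
  rewrite !coef_poly (leq_trans (ltn_ord i) NM).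
  by rewrite (leq_ltn_trans (leq_subr _ _) NM).
move=> u; have [lcvg lfg] := hl u.
suff -> : f u * g u = limn (pseries l u) by [].
rewrite -(cvg_lim _ lfg)//; apply/esym/cvg_lim => //.
under eq_fun do rewrite hornerM !tE.
by apply: cvgM; [exact: cf|exact: dg].
Qed.

Lemma pseries_diffs_ge0 c : (forall N, 0 <= c N) ->
  forall N, 0 <= pseries_diffs c N.
Proof. by move=> c0 N; rewrite /pseries_diffs mulr_ge0. Qed.

(** The terms of the derived series at [x] are dominated by those of the
    original series at [2 * (x + 1)], because [n + 1 <= 2 ^ (n + 1)]. *)
Lemma is_cvg_pseries_diffs c : (forall N, 0 <= c N) ->
  (forall u, cvgn (pseries c u)) -> forall u, cvgn (pseries (pseries_diffs c) u).
Proof.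
move=> c0 cc; apply: is_cvg_pseries_ge0; first exact: pseries_diffs_ge0.
move=> x x0; pose y := 2 * (x + 1).
have y0 : 0 <= y by rewrite mulr_ge0// addr_ge0.
have cy : cvgn (series (fun i => c i.+1 * y ^+ i.+1)).
  have := cc y; rewrite /pseries /= => /cvg_ex[L hL].
  have : series (fun i => c i * y ^+ i) n.+1 @[n --> \oo] --> L.
    by rewrite (cvg_shiftS (series (fun i => c i * y ^+ i))).
  move=> hS; apply/cvg_ex; exists (L - c 0%N).
  have -> : series (fun i => c i.+1 * y ^+ i.+1) =
     (fun n => series (fun i => c i * y ^+ i) n.+1 - c 0%N).
    apply/funext => n; rewrite /series/= big_nat_recl//= expr0 mulr1.
    by rewrite addrAC subrr add0r.
  by apply: cvgB => //; exact: cvg_cst.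
apply: series_le_cvg cy => n.
- by rewrite mulr_ge0 ?exprn_ge0// pseries_diffs_ge0.
- by rewrite mulr_ge0 ?exprn_ge0.
rewrite /= /pseries_diffs mulrAC [leLHS]mulrC ler_wpM2l// /y exprMn ler_pM ?exprn_ge0//.
  by rewrite -natrX ler_nat ltnW// ltn_expl.
by rewrite exprS -[leLHS]mul1r ler_pM ?exprn_ge0 ?lerDr ?lerXn2r ?nnegrE ?addr_ge0 ?lerDl.
Qed.

Lemma derive1_pseries c : (forall N, 0 <= c N) ->
  (forall u, cvgn (pseries c u)) ->
  (fun u => limn (pseries c u))^`()%classic = fun u => limn (pseries (pseries_diffs c) u).
Proof.
move=> c0 cc; apply/funext => u; rewrite derive1E.
have c'0 := pseries_diffs_ge0 c0; have cc' := is_cvg_pseries_diffs c0 cc.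
have cc'' := is_cvg_pseries_diffs c'0 cc'.
have D : is_derive u 1 (fun u => limn (pseries c u))
    (limn (pseries (pseries_diffs c) u)).
  apply: (@pseries_snd_diffs _ _ (`|u| + 1)) => //.
  by rewrite [ltRHS]ger0_norm ?addr_ge0// ltrDl.
exact: derive_val.
Qed.

Lemma limn_pseries_at0 c : limn (pseries c 0) = c 0%N.
Proof.
apply: lim_near_cst => //; exists 1%N => // -[|n]//= _.
rewrite /pseries /series /= big_nat_recl//= expr0 mulr1 big1 ?addr0// => i _.
by rewrite expr0n mulr0.
Qed.

Lemma taylor_coef_pseries c N : (forall N, 0 <= c N) ->
  (forall u, cvgn (pseries c u)) ->
  taylor_coef (fun u => limn (pseries c u)) N = c N.
Proof.
move=> c0 cc; pose d n := iter n (@pseries_diffs R) c.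
have dE : forall n, [/\ forall N, 0 <= d n N, forall u, cvgn (pseries (d n) u) &
    derive1n n (fun u => limn (pseries c u)) = fun u => limn (pseries (d n) u)].
  elim=> [//|n [d0 dc dE]]; split.
  - exact: pseries_diffs_ge0.
  - exact: is_cvg_pseries_diffs.
  - by rewrite derive1nS dE derive1_pseries.
have dN n i : d n i * i`!%:R = (n + i)`!%:R * c (n + i)%N.
  elim: n i => [|n IH] i; first by rewrite mulrC.
  by rewrite /d iterS -/(d n) /pseries_diffs mulrAC -natrM -factS mulrC IH addnS.
rewrite /taylor_coef; have [_ _ ->] := dE N; rewrite limn_pseries_at0.
have := dN N 0%N; rewrite mulr1 addn0 => ->; rewrite mulrAC divff ?mul1r//.
Qed.

End PowerSeries.

(** * Counting injective tuples *)

Section Counting.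
Variable T : finType.

(** An injective sequence [t] along which [g] reads off [nu] is built entry by
    entry from the right: each new entry [a] of [nu] is realised by a point of
    the fibre of [g] over [a] that has not been used yet. *)
Lemma card_uniq_tuples_map (g : T -> nat) (r : seq nat) (nu : seq nat) :
  uniq r -> {subset nu <= r} ->
  (\sum_(t : (size nu).-tuple T | uniq t && (map g t == nu)) 1 =
   \prod_(j <- r) #|[pred q | g q == j]| ^_ (count_mem j nu))%N.
Proof.
move=> ur; elim: nu => [|a nu IH] sub.
  rewrite [RHS]big1 => [|j _]; last by rewrite ffactn0.
  by rewrite (big_pred1 [tuple]) => [//|t]; rewrite (tuple0 t) /= eqxx.
have ar : a \in r by apply: sub; rewrite mem_head.
have {}IH := IH (fun x xnu => sub x (mem_behead (s := a :: nu) xnu)).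
have -> : (\prod_(j <- r) #|[pred q | g q == j]| ^_ (count_mem j (a :: nu)) =
    (\prod_(j <- r) #|[pred q | g q == j]| ^_ (count_mem j nu)) *
    (#|[pred q | g q == a]| - count_mem a nu))%N.
  rewrite !(bigD1_seq a)//= eqxx add1n ffactnSr mulnAC; congr (_ * _ * _)%N.
  by apply: eq_bigr => j /negPf ja; rewrite eq_sym ja add0n.
rewrite -IH big_distrl/=.
rewrite (reindex (fun p : (size nu).-tuple T * T => cons_tuple p.2 p.1))/=; last first.
  exists (fun t : (size nu).+1.-tuple T => (behead_tuple t, thead t)).
    by move=> [t q] _ /=; congr (_, _); exact/val_inj.
  by move=> t _ /=; rewrite [RHS]tuple_eta; exact/val_inj.
rewrite (eq_bigl (fun p : (size nu).-tuple T * T =>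
   (uniq p.1 && (map g p.1 == nu)) &&
   ((g p.2 == a) && (p.2 \notin val p.1)))); last first.
  by move=> [t q] /=; rewrite eqseq_cons; case: (g q == a); case: (q \notin _);
    rewrite ?andbT ?andbF//=.
rewrite -(pair_big_dep (fun t : (size nu).-tuple T => uniq t && (map g t == nu))
  (fun t q => (g q == a) && (q \notin val t)) (fun _ _ => 1%N))/=.
apply: eq_bigr => t /andP[ut /eqP tnu]; rewrite mul1n sum1_card.
rewrite -[in RHS](cardID (mem t)) -[X in (X + _ - _)%N](_ : count_mem a nu = _)/=.
  rewrite addKn; apply: eq_card => q; rewrite !inE andbC//.
rewrite -[in LHS]tnu count_map -size_filter -(card_uniqP (filter_uniq _ ut)).
by apply: eq_card => q; rewrite !inE mem_filter.
Qed.

End Counting.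

(** * Expanding a finite product of polynomials *)

Section Expansion.
Variables (R : comNzRingType) (n N : nat).
Implicit Types f : {ffun 'I_n -> 'I_N.+1}.

(** Here [f q] is the degree of the term taken from the [q]-th factor. Only
    degrees up to [N] matter for the coefficient of degree [N]. *)
Lemma coef_prod_poly (h : nat -> nat -> R) :
  (\prod_(q < n) \poly_(k < N.+1) h k q)`_N =
  \sum_(f : {ffun 'I_n -> 'I_N.+1} | (\sum_q f q)%N == N) \prod_q h (f q) q.
Proof.
under eq_bigr do rewrite poly_def.
rewrite bigA_distr_bigA/= coef_sum [RHS]big_mkcond/=; apply: eq_bigr => f _.
rewrite scaler_prod prodrXr coefZ coefXn eq_sym.
by case: ifP; rewrite ?mulr1 ?mulr0.
Qed.

Definition nonzero_values f : seq nat :=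
  [seq k <- [seq val (f q) | q <- enum 'I_n] | k != 0%N].

Definition type_of f : seq nat := sort geq (nonzero_values f).

Lemma geq_total : total geq.
Proof. by move=> m k; exact: leq_total. Qed.

Lemma geq_anti : antisymmetric geq.
Proof. by move=> m k; rewrite andbC => /anti_leq. Qed.

Lemma type_of_eq f nu : is_partition nu ->
  (type_of f == nu) = perm_eq (nonzero_values f) nu.
Proof.
move=> /andP[snu _]; apply/eqP/idP => [<-|fnu]; first by rewrite perm_sym perm_sort.
apply: (sorted_eq geq_trans geq_anti) => //; first exact: sort_sorted geq_total _.
by rewrite perm_sort.
Qed.

Lemma type_of_partition f : is_partition (type_of f).
Proof.
by rewrite /is_partition sort_sorted ?mem_sort ?mem_filter//; exact: geq_total.
Qed.

Lemma sumn_type_of f : sumn (type_of f) = (\sum_q f q)%N.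
Proof.
rewrite (perm_sumn (permEl (perm_sort _ _))) sumnE big_filter.
rewrite big_mkcond big_map big_enum/=.
by apply: eq_bigr => q _; case: eqP.
Qed.

(** The choice of exponents given by distinct indices [t] for the entries of
    [nu]. Off [t], [index q t] is [size nu], and the default value of [nth]
    makes the exponent [0]. *)
Definition place (nu : seq nat) (t : (size nu).-tuple 'I_n) :
    {ffun 'I_n -> 'I_N.+1} :=
  [ffun q => inord (nth 0%N nu (index q t))].

Section Place.
Variables (nu : seq nat) (nuP : is_partition nu) (nuN : sumn nu = N).

Lemma placeE (t : (size nu).-tuple 'I_n) q :
  place t q = nth 0%N nu (index q t) :> nat.
Proof.
rewrite ffunE inordK// ltnS -nuN; elim: (nu) (index q t) => [|a s IH] [|i] //=.
  exact: leq_addr.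
exact: leq_trans (IH _) (leq_addl _ _).
Qed.

Lemma place_out (t : (size nu).-tuple 'I_n) q : q \notin t ->
  place t q = 0%N :> nat.
Proof.
by move=> qt; rewrite placeE nth_default// -{1}(size_tuple t) leqNgt index_mem.
Qed.

Lemma map_place (t : (size nu).-tuple 'I_n) : uniq t ->
  [seq val (place t q) | q <- t] = nu.
Proof.
move=> ut; apply: (@eq_from_nth _ 0%N) => [|i]; rewrite size_map size_tuple// => inu.
by rewrite (nth_map (tnth t (Ordinal inu))) ?size_tuple//
  [LHS]placeE index_uniq ?size_tuple.
Qed.

Lemma perm_nonzero_values f (t : seq 'I_n) : uniq t ->
  (forall q, q \in t -> f q != 0%N :> nat) ->
  (forall q, q \notin t -> f q = 0%N :> nat) ->
  perm_eq (nonzero_values f) [seq val (f q) | q <- t].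
Proof.
move=> ut f1 f0; rewrite /nonzero_values filter_map perm_map//.
apply: uniq_perm => //; first by rewrite filter_uniq// enum_uniq.
move=> q; rewrite mem_filter mem_enum/= andbT.
by case: (boolP (q \in t)) => [/f1->|/f0->].
Qed.

Lemma type_of_place (t : (size nu).-tuple 'I_n) : uniq t ->
  type_of (place t) == nu.
Proof.
move=> ut; rewrite type_of_eq// -[X in perm_eq _ X](map_place ut).
apply: perm_nonzero_values => // [q qt|q]; last exact: place_out.
have /andP[_] := nuP; apply: contraNneq => <-.
by rewrite -[X in _ \in X](map_place ut); apply/mapP; exists q.
Qed.

(** As [f] and [nu] have equally many nonzero values, an injective [t] along
    which [f] reads off [nu] exhausts the support of [f]. *)
Lemma eq_place f (t : (size nu).-tuple 'I_n) : type_of f == nu -> uniq t ->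
  (place t == f) = (map (val \o f) t == nu).
Proof.
rewrite type_of_eq// => fnu ut; apply/eqP/eqP => [<-|ftnu]; first exact: map_place.
pose z := [seq q <- enum 'I_n | f q != 0%N :> nat].
have zt : z =i t.
  have tz : {subset t <= z}.
    move=> q qt; rewrite mem_filter mem_enum andbT.
    have /andP[_] := nuP; apply: contraNneq => <-.
    by rewrite -ftnu; apply/mapP; exists q.
  have [] := uniq_min_size ut tz; last by move=> _ h q; rewrite -h.
  by rewrite size_tuple -(perm_size fnu) /nonzero_values filter_map size_map.
apply/ffunP => q; apply/val_inj => /=; rewrite placeE.
case: (boolP (q \in t)) => qt.
  have it : (index q t < size t)%N by rewrite index_mem.
  by rewrite -[X in nth _ X](ftnu) (nth_map q)// nth_index.
rewrite -placeE place_out//; apply/esym/eqP; move: qt; rewrite -zt mem_filter.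
by rewrite mem_enum andbT negbK.
Qed.

Variables (h : nat -> nat -> R) (h0 : forall q, h 0%N q = 1).

Lemma prod_place (t : (size nu).-tuple 'I_n) : uniq t ->
  \prod_q h (place t q) q = \prod_(s < size nu) h (nth 0%N nu s) (tnth t s).
Proof.
move=> ut; rewrite (bigID (mem t))/= [X in _ * X]big1 ?mulr1 => [|q qt].
  rewrite -big_uniq//= big_tuple; apply: eq_bigr => s _.
  by rewrite placeE (tnth_nth (tnth t s)) index_uniq ?size_tuple.
by rewrite place_out.
Qed.

(** The fibre of [place nu] over each [f] of type [nu] consists of the orderings
    of the support of [f] that are compatible with [nu]: the indices carrying
    the value [j] can be permuted freely, for each [j]. *)
Lemma sum_uniq_tuples :
  \sum_(t : (size nu).-tuple 'I_n | uniq t)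
    \prod_(s < size nu) h (nth 0%N nu s) (tnth t s) =
  (\prod_(j <- undup nu) (count_mem j nu)`!)%:R *
  \sum_(f | type_of f == nu) \prod_q h (f q) q.
Proof.
rewrite (eq_bigr _ (fun t ut => esym (prod_place ut))).
rewrite (partition_big (@place nu) (fun f => type_of f == nu))/=;
  last exact: type_of_place.
rewrite mulr_sumr; apply: eq_bigr => f fnu.
rewrite (eq_bigr (fun=> \prod_q h (f q) q)) => [|t /andP[_ /eqP<-]//].
rewrite (eq_bigl (fun t : (size nu).-tuple 'I_n =>
  uniq t && (map (val \o f) t == nu))); last first.
  move=> t; case: (boolP (uniq t)) => //= ut; exact: eq_place.
rewrite sumr_const -sum1_card mulr_natl; congr (_ *+ _).
rewrite (eq_bigl (fun t : (size nu).-tuple 'I_n =>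
  uniq t && (map (val \o f) t == nu)))//.
rewrite (@card_uniq_tuples_map _ _ (undup nu)) ?undup_uniq//; last first.
  by move=> j; rewrite mem_undup.
apply: eq_big_seq => j; rewrite mem_undup => jnu.
have j0 : j != 0%N by have /andP[_] := nuP; apply: contraNneq => <-.
suff -> : #|[pred q | (val \o f) q == j]| = count_mem j nu by rewrite ffactnn.
move: fnu; rewrite type_of_eq// => /permP <-.
rewrite count_filter count_map cardE size_filter enumT.
apply: eq_count => q /=; rewrite inE.
by case: eqP => // ->; rewrite j0.
Qed.

End Place.
End Expansion.

(** * The infinite product *)

Section Product.
Variable R : realType.

(** The coefficient of [u ^+ k] in [Hfactor q u]. The case [k = 0] is separate
    since [acoef 0 q] is [1 / (q + 1)]. *)
Definition hcoef (k q : nat) : R := if k == 0%N then 1 else acoef R k q.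

Lemma hcoef_ge0 k q : 0 <= hcoef k q.
Proof.
by rewrite /hcoef; case: ifP => // _; rewrite invr_ge0 !mulr_ge0 ?exprn_ge0.
Qed.

(** Dividing the exponential series, without its constant term, by [u]. *)
Lemma pseries_expquot (q : nat) (u : R) : (0 < q)%N ->
  pseries (fun k => (k.+1`!%:R * q%:R ^+ k.+1)^-1) u @ \oo --> expquot q u.
Proof.
move=> q0; have qR : q%:R != 0 :> R by rewrite pnatr_eq0 -lt0n.
rewrite /expquot; have [->|u0] := eqVneq u 0.
  apply: cvg_near_cst; exists 1%N => // -[|n]//= _.
  rewrite /pseries/series/= big_nat_recl//= expr0 mulr1 big1 ?addr0 => [|i _].
    by rewrite mul1r expr1.
  by rewrite expr0n mulr0.
have e : series (exp_coeff (u / q%:R)) n.+1 @[n --> \oo] --> expR (u / q%:R).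
  rewrite (cvg_shiftS (series (exp_coeff (u / q%:R)))).
  exact: is_cvg_series_exp_coeff.
have -> : pseries (fun k => (k.+1`!%:R * q%:R ^+ k.+1)^-1) u =
    fun n => (series (exp_coeff (u / q%:R)) n.+1 - 1) / u.
  apply/funext => n; rewrite /pseries/series/= big_nat_recl//=.
  rewrite /exp_coeff/= expr0 fact0 divr1 addrAC subrr add0r mulr_suml.
  apply: eq_bigr => i _; rewrite expr_div_n (exprS u).
  have fR : i.+1`!%:R != 0 :> R by rewrite pnatr_eq0 -lt0n fact_gt0.
  have qi : q%:R ^+ i.+1 != 0 :> R by rewrite expf_neq0.
  move: (i.+1`!%:R) (q%:R ^+ i.+1) fR qi => a b a0 b0.
  by field; rewrite a0 b0 u0.
by apply: cvgMl; apply: cvgB => //; exact: cvg_cst.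
Qed.

Lemma pseries_Hfactor (q : nat) (u : R) : (0 < q)%N ->
  pseries (hcoef ^~ q) u @ \oo --> Hfactor q u.
Proof.
move=> q0; have qR : q%:R != 0 :> R by rewrite pnatr_eq0 -lt0n.
have -> : pseries (hcoef ^~ q) u = fun n => q%:R / q.+1%:R *
   (pseries (fun k => (1 : {poly R})`_k) u n +
    pseries (fun k => (k.+1`!%:R * q%:R ^+ k.+1)^-1) u n).
  apply/funext => n; rewrite /pseries/series/= -big_split/= mulr_sumr.
  apply: eq_bigr => k _; rewrite -mulrDl mulrA; congr (_ * _).
  rewrite coef1 /hcoef /acoef; case: k => [|k] /=.
    by rewrite (_ : 1`! = 1%N)// expr1; field; rewrite qR nat1r pnatr_eq0.
  have fR : k.+2`!%:R != 0 :> R by rewrite pnatr_eq0 -lt0n fact_gt0.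
  rewrite add0r (exprS _ k.+1).
  have qi : q%:R ^+ k.+1 != 0 :> R by rewrite expf_neq0.
  move: (k.+2`!%:R) (q%:R ^+ k.+1) fR qi => a b a0 b0.
  by field; rewrite a0 b0 qR nat1r pnatr_eq0.
apply: cvgMr; apply: cvgD; last exact: pseries_expquot.
by rewrite -[X in _ --> X](hornerC (1 : R) u); exact: pseries_horner.
Qed.

(** The coefficient of degree [N] of the product of the first [n] factors, whose
    power series may be truncated after degree [N]. *)
Definition Pcoef (n N : nat) : R :=
  (\prod_(q < n) \poly_(k < N.+1) hcoef k q.+1)`_N.

Lemma Pcoef_trunc n N M : (N < M)%N ->
  (\prod_(q < n) \poly_(k < M) hcoef k q.+1)`_N = Pcoef n N.
Proof.
rewrite /Pcoef; elim: n N M => [|n IH] N M NM; first by rewrite !big_ord0.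
rewrite !big_ord_recr/= !coefM; apply: eq_bigr => i _.
rewrite (IH i M) ?(leq_trans (ltn_ord i))// (IH i N.+1)// !coef_poly.
by rewrite !ltnS leq_subr (leq_ltn_trans (leq_subr _ _) NM).
Qed.

Lemma PcoefS n N :
  Pcoef n.+1 N = \sum_(i < N.+1) Pcoef n i * hcoef (N - i) n.+1.
Proof.
rewrite /Pcoef big_ord_recr/= coefM; apply: eq_bigr => i _.
by rewrite Pcoef_trunc// coef_poly ltnS leq_subr.
Qed.

Lemma Pcoef_ge0 n N : 0 <= Pcoef n N.
Proof.
elim: n N => [|n IH] N; first by rewrite /Pcoef big_ord0 coef1.
by rewrite PcoefS sumr_ge0// => i _; rewrite mulr_ge0// hcoef_ge0.
Qed.

Lemma Pcoef_nondecreasing N : nondecreasing_seq (Pcoef ^~ N).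
Proof.
apply/nondecreasing_seqP => n; rewrite PcoefS big_ord_recr/= subnn mulr1 lerDr.
by rewrite sumr_ge0// => i _; rewrite mulr_ge0 ?Pcoef_ge0 ?hcoef_ge0.
Qed.

Lemma pseries_Pcoef n (u : R) :
  pseries (Pcoef n) u @ \oo --> \prod_(1 <= q < n.+1) Hfactor q u.
Proof.
elim: n u => [|n IH] u.
  rewrite big_nil -[X in _ --> X](hornerC (1 : R) u).
  by rewrite /Pcoef; under eq_fun do rewrite big_ord0; exact: pseries_horner.
rewrite big_nat_recr//= (funext (PcoefS n)).
apply: (pseries_mul (Pcoef_ge0 n) (hcoef_ge0 ^~ n.+1) IH) => v.
exact: pseries_Hfactor.
Qed.

(** Since [acoef k q <= 1 / (k! q (q + 1))], the excess of the factor over [1] is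
    summable in [q], with a sum that telescopes. *)
Lemma Hfactor_le (q : nat) (x : R) : (0 < q)%N -> 0 <= x ->
  Hfactor q x <= 1 + expR x * (q%:R^-1 - q.+1%:R^-1).
Proof.
move=> q0 x0; have qR : 0 < q%:R :> R by rewrite ltr0n.
have e : 1 + pseries (fun k => k`!%:R^-1) x n * (q%:R^-1 - q.+1%:R^-1) @[n --> \oo] -->
    1 + expR x * (q%:R^-1 - q.+1%:R^-1).
  apply: cvgD; [exact: cvg_cst|apply: cvgMl].
  rewrite /pseries -exp_coeffE; exact: is_cvg_series_exp_coeff.
apply: ler_cvg_to (pseries_Hfactor q0) e _; exists 1%N => // -[|n]//= _.
have qE : q%:R^-1 - q.+1%:R^-1 = (q%:R * q.+1%:R)^-1 :> R.
  by field; rewrite nat1r (lt0r_neq0 qR) pnatr_eq0.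
rewrite qE /pseries/series/= big_nat_recl//= expr0 mulr1 lerD2l.
rewrite [in leRHS]big_nat_recl//= mulrDl ler_wpDl//.
  by rewrite mulr_ge0 ?mulr_ge0 ?invr_ge0 ?mulr_ge0.
rewrite mulr_suml; apply: ler_sum => i _; rewrite mulrAC ler_wpM2r ?exprn_ge0//.
rewrite /hcoef/= /acoef -invfM lef_pV2 ?posrE ?mulr_gt0 ?exprn_gt0 ?ltr0n ?fact_gt0//.
rewrite -natrX -!natrM ler_nat mulnA leq_mul2r leq_mul ?orbT//.
  by rewrite [leqRHS]factS leq_pmull.
by rewrite expnS leq_pmulr// expn_gt0 q0.
Qed.

Lemma prod_Hfactor_le (x : R) n : 0 <= x ->
  \prod_(1 <= q < n.+1) Hfactor q x <= expR (expR x).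
Proof.
move=> x0; have H0 q : (0 < q)%N -> 0 <= Hfactor q x.
  move=> q0; apply: cvgr_to_ge (pseries_Hfactor q0) _; apply: nearW => M.
  by apply: sumr_ge0 => k _; rewrite mulr_ge0 ?hcoef_ge0 ?exprn_ge0.
have H n' : 0 <= \prod_(1 <= q < n'.+1) Hfactor q x.
  by rewrite big_add1 prodr_ge0// => q _; exact: H0.
apply: (@le_trans _ _ (expR (expR x * (1 - n.+1%:R^-1)))); last first.
  by rewrite ler_expR ler_piMr ?expR_ge0// gerBl invr_ge0.
elim: n => [|n IH]; first by rewrite big_nil invr1 subrr mulr0 expR0.
rewrite big_nat_recr//=.
have -> : expR x * (1 - n.+2%:R^-1) =
    expR x * (1 - n.+1%:R^-1) + expR x * (n.+1%:R^-1 - n.+2%:R^-1).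
  by rewrite -mulrDr addrA subrK.
rewrite expRD ler_pM ?H0//.
by apply: le_trans (Hfactor_le _ _) (expR_ge1Dx _).
Qed.

(** Monotone convergence for the partial products: the coefficients increase
    because each factor has constant term [1]. *)
Lemma cvg_Pcoef N : Pcoef n N @[n --> \oo] --> taylor_coef (@Hprod R) N.
Proof.
have [] := @pseries_monotone_cvg R Pcoef
    (fun n u => \prod_(1 <= q < n.+1) Hfactor q u).
- exact: Pcoef_ge0.
- exact: Pcoef_nondecreasing.
- exact: pseries_Pcoef.
- by move=> x x0; exists (expR (expR x)) => n; exact: prod_Hfactor_le.
move=> l [l0 cl hl]; rewrite (_ : @Hprod R = fun u => limn (pseries l u)).
  by rewrite taylor_coef_pseries// => u; have [] := hl u.
by apply/funext => u; have [_ /cvg_lim] := hl u; apply.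
Qed.

End Product.

(** * Summing over partitions *)

Section EsumLimit.
Variables (R : realType) (T : choiceType).

(** Every finite part of [S] lies in some truncation by [rank], and the terms are
    nonnegative, so the truncated sums have the same supremum. *)
Lemma esum_cvg (S : set T) (rank : T -> nat) (a : T -> \bar R) :
  (forall x, S x -> 0 <= a x)%E ->
  (forall n, finite_set [set x | S x /\ (rank x <= n)%N]) ->
  (\sum_(x \in [set x | S x /\ (rank x <= n)%N]) a x)%E @[n --> \oo] -->
    (\esum_(x in S) a x)%E.
Proof.
move=> a0 fin; set s := (fun n => _).
have snd : nondecreasing_seq s.
  move=> m n mn; apply: lee_fsum_nneg_subset => //.
    apply/subsetP => x [Sx xm]; split=> //.
    exact: leq_trans xm mn.
  by move=> x /andP[_] /set_mem[/a0].
suff -> : (\esum_(x in S) a x)%E = ereal_sup (range s).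
  exact: ereal_nondecreasing_cvgn.
apply/eqP; rewrite eq_le; apply/andP; split; last first.
  apply: ge_ereal_sup => _ [n _ <-]; apply: ereal_sup_ubound.
  by exists [set x | S x /\ (rank x <= n)%N] => //; split=> // x [].
apply: ge_ereal_sup => _ [A [finA AS] <-].
pose n := (\max_(x <- fset_set A) rank x)%N.
apply: (@le_trans _ _ (s n)); last by apply: ereal_sup_ubound; exists n.
apply: lee_fsum_nneg_subset => //.
  apply/subsetP => x Ax; split; first exact: AS.
  by apply: leq_bigmax_seq => //; rewrite in_fset_set//; exact: mem_set.
by move=> x /andP[_] /set_mem[/a0].
Qed.

End EsumLimit.

Section Assembly.
Variable R : realType.

(** An entry [i : 'I_n] stands for the positive integer [i.+1]. *)
Definition Cpart_upto (nu : seq nat) (n : nat) : R :=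
  (\prod_(j <- undup nu) (count_mem j nu)`!)%:R^-1 *
  \sum_(t : (size nu).-tuple 'I_n | uniq t)
    \prod_(s < size nu) acoef R (nth 0%N nu s) (tnth t s).+1.

Definition succ_tuple d n (t : d.-tuple 'I_n) : d.-tuple nat :=
  map_tuple (fun i : 'I_n => i.+1) t.

Lemma succ_tuple_bij d n :
  set_bij [set t : d.-tuple 'I_n | uniq t]
    [set t : d.-tuple nat |
      distinct_pos t /\ (\max_(s < d) tnth t s <= n)%N]
    (@succ_tuple d n).
Proof.
have inj : injective (fun i : 'I_n => i.+1) by move=> i j [] /val_inj.
split=> [t ut|t t' _ _ tt'|t [[ut t0] tn]] /=.
- split; [split=> [|s]|].
  + by rewrite map_inj_uniq.
  + by rewrite tnth_map.
  + by apply/bigmax_leqP => s _; rewrite tnth_map.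
- apply/val_inj/(inj_map inj); exact: (congr1 val tt').
have {}tn s : ((tnth t s).-1 < n)%N.
  by rewrite prednK ?t0//; move/bigmax_leqP : tn; apply.
have e : succ_tuple [tuple Ordinal (tn s) | s < d] = t.
  by apply: eq_from_tnth => s; rewrite !tnth_map tnth_ord_tuple/= prednK ?t0.
exists [tuple Ordinal (tn s) | s < d] => //=.
by move: ut; rewrite -{1}e /= map_inj_uniq.
Qed.

Lemma cvg_Cpart_upto (nu : seq nat) :
  (Cpart_upto nu n)%:E @[n --> \oo] --> Cpart R nu.
Proof.
pose F (t : (size nu).-tuple nat) : R :=
  \prod_(s < size nu) acoef R (nth 0%N nu s) (tnth t s).
have F0 t : (0 <= (F t)%:E)%E.
  by rewrite lee_fin prodr_ge0// => s _; rewrite invr_ge0 !mulr_ge0 ?exprn_ge0.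
rewrite /Cpart; under eq_fun do rewrite /Cpart_upto EFinM.
apply: cvgeZl => //.
pose rank (t : (size nu).-tuple nat) := (\max_(s < size nu) tnth t s)%N.
have -> : (fun n => (\sum_(t : (size nu).-tuple 'I_n | uniq t)
    \prod_(s < size nu) acoef R (nth 0%N nu s) (tnth t s).+1)%:E) =
  (fun n => \sum_(t \in [set t | distinct_pos t /\ (rank t <= n)%N]) (F t)%:E)%E.
  apply/funext => n; rewrite (reindex_fsbig _ _ _ _ (@succ_tuple_bij _ n)).
  rewrite -sumEFin [LHS]bigfs ?index_enum_uniq//=; last first.
    by move=> t _; rewrite mem_index_enum.
  apply: eq_fsbigr => t _; congr _%:E; apply: eq_bigr => s _.
  by rewrite tnth_map.
apply: esum_cvg => // n.
have [_ _ surj] := @succ_tuple_bij (size nu) n.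
apply: sub_finite_set surj _; exact/finite_image/finite_finset.
Qed.

(** Grouping the terms of the expansion of the product by the multiset of the
    chosen exponents: a choice of type [nu] comes from
    [\prod_j (count_mem j nu)`!] tuples. *)
Lemma Pcoef_sum_Cpart_upto n N :
  Pcoef R n N = \sum_(nu <- fset_set (partitions N)) Cpart_upto nu n.
Proof.
have memP nu : (nu \in fset_set (partitions N)) = (nu \in partitions N).
  by rewrite in_fset_set//; exact: finite_partitions.
rewrite /Pcoef (coef_prod_poly _ _ (fun k q => hcoef R k q.+1)).
rewrite big_seq.
under [RHS]eq_bigr => nu.
  rewrite memP => /set_mem[nuP nuN].
  have nu0 : 0%N \notin nu by case/andP: nuP.
  rewrite /Cpart_upto.
  have -> : \sum_(t : (size nu).-tuple 'I_n | uniq t)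
      \prod_(s < size nu) acoef R (nth 0%N nu s) (tnth t s).+1 =
    \sum_(t : (size nu).-tuple 'I_n | uniq t)
      \prod_(s < size nu) hcoef R (nth 0%N nu s) (tnth t s).+1.
    apply: eq_bigr => t _; apply: eq_bigr => s _; rewrite /hcoef ifN//.
    by apply: contraNneq nu0 => <-; rewrite mem_nth.
  rewrite (@sum_uniq_tuples _ n N nu nuP nuN (fun k q => hcoef R k q.+1))//.
  rewrite mulKf; last by rewrite pnatr_eq0 -lt0n prodn_gt0// => j; rewrite fact_gt0.
  rewrite big_mkcond/=.
  over.
rewrite /= -big_seq exchange_big/= [LHS]big_mkcond/=; apply: eq_bigr => f _.
case: ifPn => [/eqP fN|fN].
  have fP : type_of f \in fset_set (partitions N).
    rewrite memP; apply/mem_set; split; first exact: type_of_partition.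
    by rewrite sumn_type_of.
  rewrite (bigD1_seq (type_of f)) ?fset_uniq//= eqxx [X in _ + X]big1 ?addr0// => nu.
  by rewrite eq_sym => /negPf ->.
rewrite big_seq big1// => nu; rewrite memP => /set_mem[_ nuN].
by case: eqP => // fnu; move: fN; rewrite -sumn_type_of fnu nuN eqxx.
Qed.

End Assembly.

Theorem theorem4p2 (R : realType) (r : nat) (hr : (2 <= r)%N) :
  set_bij (partitions r.-1) (shape_families r.-1) shape_family /\
  ((Ccoef R r)%:E = \sum_(nu \in partitions r.-1) Cpart R nu)%E.
Proof.
split; first exact: shape_family_bij.
have lim_sum : (Pcoef R n r.-1)%:E @[n --> \oo] -->
    (\sum_(nu \in partitions r.-1) Cpart R nu)%E.
  rewrite fsbig_finite; last exact: finite_partitions.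
  under eq_fun do rewrite Pcoef_sum_Cpart_upto -sumEFin.
  apply: cvg_nnesum => nu _; last exact: cvg_Cpart_upto.
  apply: nearW => n; rewrite lee_fin /Cpart_upto mulr_ge0 ?invr_ge0// sumr_ge0//.
  move=> t _; rewrite prodr_ge0// => s _.
  by rewrite invr_ge0 !mulr_ge0 ?exprn_ge0.
have lim_taylor : (Pcoef R n r.-1)%:E @[n --> \oo] --> (Ccoef R r)%:E.
  by apply: cvg_EFin; [exact: nearW|exact: cvg_Pcoef].
exact: cvg_unique lim_taylor lim_sum.
Qed.
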